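(* Let $G=(V,E)$ be a simple undirected graph on $n\geq 4$ vertices with no isolated vertices. Let $r$ be the number of vertices of degree $1$ and $p$ the number of vertices of degree $n-1$, and write $d(v)$ for the degree of a vertex $v$. Then $G$ is an equimatchable split graph if and only if at least one of the following holds: (i) $p=n$; (ii) $r=n-1$ and $p=1$; (iii) $p=1$, $r\geq 2$, $n-r$ is even, and every vertex has degree $1$, $n-r-1$ or $n-1$; (iv) $p=0$, $r\geq 2$, $n-r$ is even, and there are two vertices $x,y$ with $xy\notin E$, $d(x)=n-2$, $d(y)=n-r-2$, such that every vertex in $V\setminus\{x,y\}$ has degree $1$ or $n-r-1$; (v) $n$ is odd and there are two vertices $x,y$ with $d(x)+d(y)=p+n-2$ such that every vertex in $V\setminus\{x,y\}$ has degree $n-1$ or $n-2$.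
   Context: A matching is a set of pairwise vertex-disjoint edges; it is maximal if it is not properly contained in another matching. A graph is equimatchable if all its maximal matchings have the same number of edges. A graph is split if its vertex set can be partitioned into a clique and an independent set. A vertex is isolated if it has degree $0$. *)

(* Defs.v *)
From mathcomp Require Import all_boot.

Set Implicit Arguments.
Unset Strict Implicit.
Unset Printing Implicit Defensive.

(* A simple undirected graph on the vertex set T is given by its adjacency
   relation e, with symmetry and irreflexivity assumed where needed. *)
Section Graph.

Variables (T : finType) (e : rel T).

Definition degree (v : T) : nat := #|[set w | e v w]|.

Definition isolated (v : T) : bool := degree v == 0.

Definition num_deg (k : nat) : nat := #|[set v | degree v == k]|.

Definition edges : {set {set T}} := [set [set x; y] | x in T, y in T & e x y].

Definition matching (M : {set {set T}}) : bool :=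
  (M \subset edges) && trivIset M.

Definition maximal_matching (M : {set {set T}}) : bool := maxset matching M.

Definition equimatchable : Prop :=
  forall M N : {set {set T}},
    maximal_matching M -> maximal_matching N -> #|M| = #|N|.

Definition clique (K : {set T}) : Prop :=
  {in K &, forall x y, x != y -> e x y}.

Definition independent (I : {set T}) : Prop :=
  {in I &, forall x y, ~~ e x y}.

(* As usual, either part of the partition may be empty. *)
Definition split_graph : Prop :=
  exists K : {set T}, clique K /\ independent (~: K).

End Graph.

(* Main.v *)
(** A maximal matching is one whose uncovered vertices are independent, so the
    graph is equimatchable iff all vertex sets covered by a matching and having
    an independent complement have the same size.

    Let [K] be a maximal clique with independent complement [I].  If [#|K|] is
    even, two disjoint edges between [K] and [I] would give an augmenting path
    of length three for a perfect matching of [K]; so these edges form a star,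
    and its centre is in [K] as soon as [#|I| > 1].  If [#|K|] is odd, every vertex
    of [K] has a neighbour in [I], since otherwise a near-perfect matching of
    [K] missing it is maximal but not maximum; and for disjoint edges [u a] and
    [v b] the remaining vertices of [K] see nothing in [I] but [a] and [b].
    This leaves three shapes: complete graphs, odd cliques with one vertex
    ([pendant_clique]) carrying all the pendant vertices, and cliques plus two
    non-adjacent vertices ([clique_minus_pair]).  Each of them is equimatchable
    by a parity count and is recovered from its degrees; for (v) this uses that
    the bound "each vertex other than [x], [y] misses at most one vertex" is
    attained with equality. *)

Require Import Defs.
From mathcomp Require Import all_boot zify.

Set Implicit Arguments.
Unset Strict Implicit.
Unset Printing Implicit Defensive.

(** * Matchings and the vertex sets they cover *)

Section Matchable.

Variables (T : finType) (e : rel T).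
Hypotheses (e_sym : symmetric e) (e_irr : irreflexive e).
Implicit Types (x y z u v w : T) (A B K S : {set T}) (M N : {set {set T}}).

(** Covered vertex sets stand in for matchings: a matching covers twice as many vertices as it has
    edges, so comparing sizes becomes counting vertices, with parity at hand. *)
Definition matchable A : Prop := exists2 M, matching e M & cover M = A.

Lemma adj_neq x y : e x y -> x != y.
Proof. by apply: contraTneq => ->; rewrite e_irr. Qed.

Lemma edgesP A :
  reflect (exists x y, e x y /\ A = [set x; y]) (A \in edges e).
Proof.
apply: (iffP imset2P) => [[x y _ exy ->]|[x [y [exy ->]]]].
  by move: exy; rewrite !inE => exy; exists x, y.
by exists x y; rewrite ?inE ?exy.
Qed.

Lemma matching_edge M A :
  matching e M -> A \in M -> exists x y, e x y /\ A = [set x; y].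
Proof. by case/andP=> /subsetP sM _ /sM /edgesP. Qed.

Lemma card_cover_matching M : matching e M -> #|cover M| = #|M|.*2.
Proof.
move=> mM; have /andP[_ /eqP <-] := mM.
rewrite (eq_bigr (fun=> 2)) => [|A /(matching_edge mM)[x [y [exy ->]]]].
  by rewrite sum_nat_const muln2.
by rewrite cards2 (adj_neq exy).
Qed.

(** The second conjunct is what contradicts the maximality of [M] in [maximal_matchingP]. *)
Lemma matchingU1 M x y :
    matching e M -> e x y -> x \notin cover M -> y \notin cover M ->
  matching e ([set x; y] |: M) /\ [set x; y] \notin M.
Proof.
move=> mM exy xM yM; have /andP[sM tM] := mM.
have dM : {in M, forall B : {set T}, [disjoint [set x; y] & B]}.
  move=> B BM; rewrite -setI_eq0 setIUl.
  apply/eqP/setP => z; rewrite !inE.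
  apply/negP => /orP[] /andP[/eqP-> zB].
    by case/bigcupP: xM; exists B.
  by case/bigcupP: yM; exists B.
have M0 : set0 \notin M.
  apply/negP => /(matching_edge mM)[a [b [_ /setP/(_ a)]]].
  by rewrite !inE eqxx.
have [tU nM] := trivIsetU1 dM tM M0; split=> //.
rewrite /matching tU andbT subUset sM sub1set andbT.
by apply/edgesP; exists x, y.
Qed.

Lemma maximal_matchingP M :
  maximal_matching e M <-> matching e M /\ independent e (~: cover M).
Proof.
split=> [/maxsetP[mM maxM]|[mM indM]].
  split=> // x y; rewrite !inE => xM yM; apply/negP => exy.
  have [mU /negP[]] := matchingU1 mM exy xM yM.
  by rewrite -(maxM _ mU (subsetUr _ _)) setU11.
apply/maxsetP; split=> // N mN sMN; apply/eqP; rewrite eqEsubset sMN andbT.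
apply/subsetP => A AN; apply: contraT => AM.
have [x [y [exy defA]]] := matching_edge mN AN.
(* The edges of [M] lie in [N] and differ from [A], hence are disjoint from it; so both ends of [A]
   are uncovered, yet adjacent. *)
have notM z : z \in A -> z \in ~: cover M.
  move=> zA; rewrite inE; apply/negP => /bigcupP[B BM zB].
  have /andP[_ /trivIsetP tN] := mN.
  have nAB : A != B by apply: contraNneq AM => ->.
  have := tN _ _ AN (subsetP sMN _ BM) nAB.
  by rewrite -setI_eq0 => /eqP/setP/(_ z); rewrite !inE zA zB.
have [xA yA] : x \in A /\ y \in A by rewrite defA !inE !eqxx orbT.
by have := indM x y (notM x xA) (notM y yA); rewrite exy.
Qed.

Lemma equimatchableP :
  equimatchable e <->
  (forall A B, matchable A -> independent e (~: A) ->
               matchable B -> independent e (~: B) -> #|A| = #|B|).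
Proof.
split=> [eqm _ _ [M mM <-] iM [N mN <-] iN|eqc M N].
  rewrite !card_cover_matching //; congr _.*2.
  by apply: eqm; apply/maximal_matchingP.
move=> /maximal_matchingP[mM iM] /maximal_matchingP[mN iN].
apply: double_inj; rewrite -!card_cover_matching //.
by apply: eqc => //; [exists M | exists N].
Qed.

Lemma matchable_even A : matchable A -> ~~ odd #|A|.
Proof. by case=> M /card_cover_matching cM <-; rewrite cM odd_double. Qed.

Lemma matchable0 : matchable set0.
Proof.
exists set0; last by rewrite /cover big_set0.
by rewrite /matching sub0set; apply/trivIsetP => A B; rewrite inE.
Qed.

Lemma matchableU1 A x y :
  matchable A -> e x y -> x \notin A -> y \notin A -> matchable (x |: (y |: A)).
Proof.
move=> [M mM <-] exy xM yM; exists ([set x; y] |: M).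
  by have [] := matchingU1 mM exy xM yM.
by rewrite /cover bigcup_setU big_set1 setUA.
Qed.

(** The witness [y] is the partner of [x] in a matching covering [A]. Applied to pendant vertices,
    this exposes forced edges. *)
Lemma matchableD1 A x :
  matchable A -> x \in A ->
  exists y, [/\ e x y, y \in A & matchable (A :\ x :\ y)].
Proof.
move=> [M mM <-] /bigcupP[B BM xB].
have [y exy defB] : exists2 y, e x y & B = [set x; y].
  have [a [b [eab defB]]] := matching_edge mM BM.
  move: xB; rewrite defB !inE => /orP[]/eqP->; first by exists b.
  by exists a; rewrite 1?e_sym // setUC.
have /andP[sM tM] := mM.
exists y; split=> //.
  by apply/bigcupP; exists B => //; rewrite defB !inE eqxx orbT.
exists (M :\ B); last by rewrite coverD1 // defB setDDl.
rewrite /matching (subset_trans (subsetDl _ _) sM).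
exact: trivIsetS (subsetDl _ _) tM.
Qed.

Lemma cliqueS A B : A \subset B -> clique e B -> clique e A.
Proof. by move=> /subsetP sAB cB x y /sAB xB /sAB; apply: cB. Qed.

Lemma independentS A B : A \subset B -> independent e B -> independent e A.
Proof. by move=> /subsetP sAB iB x y /sAB xB /sAB; apply: iB. Qed.

Lemma clique_matchable K : clique e K -> ~~ odd #|K| -> matchable K.
Proof.
have [m] := ubnP #|K|; elim: m K => // m IH K ltKm cK evK.
have [->|[x xK]] := set_0Vmem K; first exact: matchable0.
have cKx := cardsD1 x K.
have [K0|[y yK]] := set_0Vmem (K :\ x).
  by move: evK; rewrite cKx xK K0 cards0.
have cKy := cardsD1 y (K :\ x).
move: (yK); rewrite !inE => /andP[yx yK'].
rewrite -(setD1K xK) -(setD1K yK).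
apply: matchableU1; rewrite ?inE ?eqxx ?andbF //.
  apply: IH; [lia | | lia].
  by apply: cliqueS cK; rewrite setDDl subsetDl.
by apply: cK; rewrite // eq_sym.
Qed.

Lemma clique_independent_le1 K A :
  clique e K -> independent e A -> A \subset K -> #|A| <= 1.
Proof.
move=> cK iA /subsetP sAK; apply/card_le1_eqP => x y xA yA.
apply/eqP/contraT => nxy.
by have := iA x y xA yA; rewrite cK // ?sAK // eq_sym.
Qed.


(** * The shapes are split and equimatchable *)

(* The common shape of (ii), (iii) and (iv): [K] is an odd clique, every vertex
   outside [x |: K] is pendant at [x], and [x] is joined to all of [K] except
   possibly [y]. *)
Definition pendant_clique x y K : Prop :=
  [/\ [/\ y \in K, x \notin K, clique e K & odd #|K|],
      {in K, forall z, z != y -> e x z}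
    & forall v w, v != x -> v \notin K -> e v w -> w = x].

Lemma pendant_clique_split x y K : pendant_clique x y K -> split_graph e.
Proof.
(* Since [x y] may be a non-edge, [y] moves to the independent side; the other vertices there have
   [x] as their only neighbour. *)
move=> [[yK xK cK _] xadj pend]; exists (x |: (K :\ y)); split=> v w.
  rewrite !inE => /predU1P[->|/andP[vy vK]] /predU1P[->|/andP[wy wK]].
  - by rewrite eqxx.
  - by move=> _; apply: xadj.
  - by move=> _; rewrite e_sym; apply: xadj.
  - exact: cK.
rewrite !inE !negb_or !negb_and !negbK => /andP[vx vP] /andP[wx wP].
apply/negP => evw.
have [/eqP vy|vK] := orP vP; last first.
  by rewrite (pend _ _ vx vK evw) eqxx in wx.
have [/eqP wy|wK] := orP wP; last first.
  by move: evw; rewrite e_sym => /(pend _ _ wx wK) vx'; rewrite vx' eqxx in vx.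
by rewrite vy wy e_irr in evw.
Qed.

Hypothesis no_isolated : forall v, ~~ isolated e v.

Lemma has_neighbor v : exists w, e v w.
Proof.
have := no_isolated v; rewrite /isolated cards_eq0 => /set0Pn[w].
by rewrite inE => evw; exists w.
Qed.

Lemma pendant_clique_adj x y K v :
  pendant_clique x y K -> v != x -> v \notin K -> e v x.
Proof.
move=> [_ _ pend] vx vK; have [w evw] := has_neighbor v.
by rewrite -(pend v w vx vK evw).
Qed.

(** The vertex [x] is covered, since the pendant [q] is either matched to it or uncovered and
    adjacent to it. Once the edge [x w] is removed, the covered vertices lie in [K], and at most one
    vertex of [K] is uncovered. As [#|K|] is odd, exactly one is uncovered if [w] is outside [K],
    and none otherwise; the count is the same. *)
Lemma pendant_clique_card x y K A :
  pendant_clique x y K -> (exists v, (v != x) && (v \notin K)) ->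
  matchable A -> independent e (~: A) -> #|A| = #|K|.+1.
Proof.
move=> pK [q /andP[qx qK]] mA iA; have adjx v := @pendant_clique_adj x y K v pK.
have [[yK xK cK oddK] xadj pend] := pK.
have xA : x \in A.
  apply: contraT => xA; have [qA|qA] := boolP (q \in A).
    have [w [eqw wA _]] := matchableD1 mA qA.
    by rewrite (pend q w) // in wA; rewrite wA in xA.
  by have := iA q x; rewrite !inE (adjx q qx qK) => /(_ qA xA).
have [w [exw wA mA']] := matchableD1 mA xA.
have sAK : A :\ x :\ w \subset K.
  apply/subsetP => v; rewrite !inE => /and3P[vw vx vA].
  apply: contraT => vK.
  have vA' : v \in A :\ x :\ w by rewrite !inE vw vx.
  have [u [evu]] := matchableD1 mA' vA'.
  by rewrite (pend v u) // !inE eqxx andbF.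
have wx : w \in A :\ x by rewrite !inE wA eq_sym adj_neq.
have cA1 := cardsD1 x A; have cA2 := cardsD1 w (A :\ x).
have evA' := matchable_even mA'.
have missing : #|K :\: A| <= 1.
  apply: (@clique_independent_le1 K) => //; last exact: subsetDl.
  by apply: independentS iA; rewrite setDE subsetIr.
have splitK : #|K| = #|A :\ x :\ w| + #|K :\: A| + (w \in K).
  have -> : A :\ x :\ w = (K :&: A) :\ w.
    apply/setP => v; rewrite !inE.
    have := subsetP sAK v; rewrite !inE.
    case: (altP (v =P x)) => [->|_] /=; first by rewrite (negbTE xK) andbF.
    by case: (v == w) => //=; case: (v \in A) => /= [->|_] //; rewrite andbF.
  by rewrite -(cardsID A K) (cardsD1 w (K :&: A)) inE wA andbT -addnA addnC.
rewrite cA1 xA cA2 wx; move: missing oddK; rewrite splitK.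
rewrite !oddD (negbTE evA').
by case: (w \in K); case: #|K :\: A| => [|[|m]] //= _ _; rewrite ?addn0 ?addn1.
Qed.

Lemma pendant_clique_equimatchable x y K :
  pendant_clique x y K -> (exists v, (v != x) && (v \notin K)) ->
  equimatchable e.
Proof.
move=> pK exq; apply/equimatchableP => A B mA iA mB iB.
by rewrite (pendant_clique_card pK exq mA) // (pendant_clique_card pK exq mB).
Qed.

(* The shape of (v) when the graph is not complete. *)
Definition clique_minus_pair x y : Prop :=
  [/\ x != y, ~~ e x y, clique e (~: [set x; y])
    & forall z, z != x -> z != y -> e z x || e z y].

Lemma clique_minus_pair_split x y : clique_minus_pair x y -> split_graph e.
Proof.
move=> [nxy exy cK _]; exists (~: [set x; y]); split=> // u v.
rewrite !inE !negbK => /orP[]/eqP-> /orP[]/eqP->; rewrite ?e_irr //.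
by rewrite e_sym.
Qed.

(** The number of uncovered vertices is odd, so it suffices to bound it by 2. If they are not all in
    the pair, an uncovered [v] outside is adjacent to [x] or [y], so at most one of these is
    uncovered, and the clique contributes at most one vertex. *)
Lemma clique_minus_pair_equimatchable x y :
  clique_minus_pair x y -> odd #|T| -> equimatchable e.
Proof.
move=> [nxy exy cK dom] oddT; apply/equimatchableP.
suff main A : matchable A -> independent e (~: A) -> #|A| = #|T|.-1.
  by move=> A B mA iA mB iB; rewrite (main A) ?(main B).
move=> mA iA; have := matchable_even mA; have := cardsC A.
suff: #|~: A| <= 2 by lia.
have [v /andP[]|out] := pickP [pred v in ~: A | v \notin [set x; y]].
  rewrite !inE negb_or => vA /andP[vx vy].
  have nonadj z : z \notin A -> ~~ e v z.
    by move=> zA; apply: iA; rewrite inE.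
  have cA : #|~: A :\: [set x; y]| <= 1.
    apply: (@clique_independent_le1 (~: [set x; y])) => //.
      exact: independentS (subsetDl _ _) iA.
    by rewrite setDE subsetIr.
  have : #|~: A :&: [set x; y]| <= 1.
    apply/card_le1_eqP => a b; rewrite !inE.
    move=> /andP[aA /orP[]/eqP ea] /andP[bA /orP[]/eqP eb];
      rewrite ?ea ?eb // in aA bA *; have := dom v vx vy.
      by rewrite (negbTE (nonadj x aA)) (negbTE (nonadj y bA)).
    by rewrite (negbTE (nonadj x bA)) (negbTE (nonadj y aA)).
  by move: cA; have := cardsID [set x; y] (~: A); lia.
apply: (@leq_trans #|[set x; y]|); last by rewrite cards2 nxy.
apply: subset_leq_card; apply/subsetP => v vA.
by have := out v; rewrite [_ v]/= vA => /negbFE.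
Qed.

Lemma complete_split : clique e [set: T] -> split_graph e.
Proof. by move=> cT; exists [set: T]; split=> // x y; rewrite !inE. Qed.

Lemma complete_equimatchable : clique e [set: T] -> equimatchable e.
Proof.
move=> cT; apply/equimatchableP.
suff main A : matchable A -> independent e (~: A) -> #|A| = #|T| - odd #|T|.
  by move=> A B mA iA mB iB; rewrite (main A) ?(main B).
move=> /matchable_even mA iA.
have := clique_independent_le1 cT iA (subsetT _); have := cardsC A.
lia.
Qed.

(** * Equimatchable split graphs have one of three shapes *)

Local Notation n := #|T|.

(** One enlargement suffices: after an outer [a] complete to [K] is added, every remaining outer
    vertex misses [a] itself. *)
Lemma split_maximal_clique :
  split_graph e -> exists K, [/\ clique e K, independent e (~: K)
                     & forall a, a \notin K -> exists2 z, z \in K & ~~ e a z].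
Proof.
move=> [K [cK iK]].
have [a /andP[aK /forall_inP adj]|max] :=
    pickP [pred a | (a \notin K) && [forall z in K, e a z]]; last first.
  exists K; split=> // a aK; have := max a; rewrite /= aK /= => /negbT.
  by rewrite negb_forall_in => /exists_inP.
exists (a |: K); split.
- move=> x y; rewrite !inE => /predU1P[->|xK] /predU1P[->|yK].
  + by rewrite eqxx.
  + by move=> _; apply: adj.
  + by move=> _; rewrite e_sym; apply: adj.
  + exact: cK.
- by apply: independentS iK; rewrite setCS subsetUr.
move=> b; rewrite !inE negb_or => /andP[ba bK].
by exists a; rewrite ?inE ?eqxx //; apply: iK; rewrite inE.
Qed.

Section Forward.

Hypothesis eqm : equimatchable e.

(* Otherwise the length-three path [a u v b] augments the maximal matching made
   of [u v] and a perfect matching of [S]. *)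
Lemma no_augmenting_path u v a b S :
    e u v -> e u a -> e v b -> [/\ a != b, a != v & b != u] ->
    [/\ u \notin S, v \notin S, a \notin S & b \notin S] -> matchable S ->
  ~ independent e (~: (u |: (v |: S))).
Proof.
move=> euv eua evb [ab av bu] [uS vS aS bS] mS iS.
have uv := adj_neq euv; have ua := adj_neq eua; have vb := adj_neq evb.
have vbU w : w != v -> w != b -> w \notin S -> w \notin v |: (b |: S).
  by move=> wv wb wS; rewrite !inE !negb_or wv wb.
have mA : matchable (u |: (v |: S)) by apply: matchableU1.
have mB : matchable (u |: (a |: (v |: (b |: S)))).
  apply: matchableU1 => //; first exact: matchableU1.
    by rewrite vbU // eq_sym.
  exact: vbU.
have iB : independent e (~: (u |: (a |: (v |: (b |: S))))).
  apply: independentS iS; rewrite setCS setUS // subsetU // setUS ?orbT //.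
  exact: subsetUr.
have := proj1 equimatchableP eqm _ _ mA iS mB iB.
rewrite !cardsU1 !inE !negb_or uv ua vb av ab uS vS aS bS (eq_sym u b) bu.
by lia.
Qed.

Variable K : {set T}.
Hypotheses (cK : clique e K) (iK : independent e (~: K)).
Hypothesis maxK : forall a, a \notin K -> exists2 z, z \in K & ~~ e a z.

Lemma outer_neighbor a w : a \notin K -> e a w -> w \in K.
Proof.
move=> aK eaw; apply: contraT => wK.
by have := iK (_ : a \in ~: K) (_ : w \in ~: K); rewrite !inE eaw => /(_ aK wK).
Qed.

Lemma in_out_neq u a : u \in K -> a \notin K -> (a != u) * (u != a).
Proof.
by move=> uK aK; rewrite eq_sym; split; apply: contraNneq aK => <-.
Qed.

(** The outer vertices [a] and [b] share their neighbour [x]. An edge [w c] with [w] other than [x]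
    would force [c] to equal both of them; thus the second outer vertex rules out a centre outside
    [K]. *)
Lemma star_of_no_disjoint_edges :
    (forall u v a b, u \in K -> v \in K -> a \notin K -> b \notin K ->
       u != v -> e u a -> e v b -> a = b) ->
    1 < #|~: K| ->
  exists2 x, x \in K & forall a w, a \notin K -> e a w -> w = x.
Proof.
move=> noedges /card_gt1P[a [b [aK bK ab]]]; rewrite !inE in aK bK.
have [x eax] := has_neighbor a; have [y eby] := has_neighbor b.
have xK := outer_neighbor aK eax; have yK := outer_neighbor bK eby.
have xa : e x a by rewrite e_sym.
have yb : e y b by rewrite e_sym.
have xy : y = x.
  by apply/eqP/contraT => yx; rewrite (noedges y x b a) ?eqxx // in ab.
exists x => // c w cNK ecw; have wK := outer_neighbor cNK ecw.
have wc : e w c by rewrite e_sym.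
rewrite xy in yb; apply/eqP/contraT => wx.
by rewrite -(noedges w x c a) // (noedges w x c b) ?eqxx // in ab.
Qed.

Lemma even_clique_no_disjoint_edges u v a b :
    ~~ odd #|K| -> u \in K -> v \in K -> a \notin K -> b \notin K ->
  u != v -> e u a -> e v b -> a = b.
Proof.
move=> evK uK vK aK bK uv eua evb; apply/eqP/contraT => ab; exfalso.
have cardK : #|K| = #|K :\ u :\ v|.+2.
  by rewrite (cardsD1 u) uK (cardsD1 v) !inE vK eq_sym uv.
apply: (@no_augmenting_path u v a b (K :\ u :\ v)) => //.
- exact: cK.
- by rewrite ab !(in_out_neq _ aK) ?(in_out_neq _ bK).
- by rewrite !inE !eqxx (negbTE aK) (negbTE bK) !andbF.
- apply: clique_matchable; last by rewrite cardK /= negbK in evK.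
  by apply: cliqueS cK; rewrite setDDl subsetDl.
rewrite setD1K ?inE ?vK ?(eq_sym v) ?uv // setD1K //.
Qed.

(** If [z] saw only [K], pairing up [K :\ z] would be maximal and cover [#|K| - 1] vertices, whereas
    an edge [a x] together with a pairing of [K :\ x] covers [#|K| + 1]. *)
Lemma odd_clique_outer_neighbor z :
  odd #|K| -> 0 < #|~: K| -> z \in K -> exists2 a, a \notin K & e z a.
Proof.
move=> oddK /card_gt0P[a]; rewrite inE => aK zK.
have [b /andP[bK ezb]|noz] := pickP [pred b | (b \notin K) && e z b].
  by exists b.
have {}noz b : b \notin K -> ~~ e z b.
  by move=> bK; have := noz b; rewrite /= bK /= => /negbT.
have evD x : x \in K -> matchable (K :\ x).
  move=> xK; apply: clique_matchable; first exact: cliqueS (subsetDl _ _) cK.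
  by move: oddK; rewrite (cardsD1 x) xK.
have [x eax] := has_neighbor a; have xK := outer_neighbor aK eax.
have mB : matchable (a |: (x |: (K :\ x))).
  apply: matchableU1 => //; first exact: evD.
    by rewrite !inE negb_and aK orbT.
  by rewrite !inE eqxx.
have iB : independent e (~: (a |: (x |: (K :\ x)))).
  by rewrite setD1K //; apply: independentS iK; rewrite setCS subsetUr.
have iA : independent e (~: (K :\ z)).
  move=> u v; rewrite !inE !negb_and !negbK.
  move=> /orP[/eqP->|uK] /orP[/eqP->|vK].
  - by rewrite e_irr.
  - exact: noz.
  - by rewrite e_sym; apply: noz.
  by apply: iK; rewrite inE.
have := proj1 equimatchableP eqm _ _ (evD z zK) iA mB iB.
by rewrite setD1K // cardsU1 aK (cardsD1 z K) zK; lia.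
Qed.

(** Another outer neighbour [c] would give a third disjoint edge [w c]. With a pairing of the even
    rest of [K] it covers the set [S] of [no_augmenting_path]. *)
Lemma odd_clique_disjoint_edges u v a b w :
    odd #|K| -> u \in K -> v \in K -> a \notin K -> b \notin K ->
    u != v -> e u a -> e v b -> a != b -> w \in K -> w != u -> w != v ->
  forall c, c \notin K -> e w c -> c = a \/ c = b.
Proof.
move=> oddK uK vK aK bK uv eua evb ab wK wu wv c cK' ewc.
have [->|ca] := eqVneq c a; first by left.
have [->|cb] := eqVneq c b; first by right.
exfalso; set R := K :\ u :\ v :\ w.
have cardK : #|K| = #|R|.+3.
  rewrite (cardsD1 u) uK (cardsD1 v) !inE vK eq_sym uv.
  by rewrite (cardsD1 w) !inE wK wu wv.
have RK : R \subset K by rewrite /R !setDDl subsetDl.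
have cR : c \notin R by apply: contra cK' => /(subsetP RK).
have mR : matchable R.
  apply: clique_matchable; first exact: cliqueS RK cK.
  by move: oddK; rewrite cardK /= negbK.
apply: (@no_augmenting_path u v a b (w |: (c |: R))) => //.
- exact: cK.
- by rewrite ab !(in_out_neq _ aK) ?(in_out_neq _ bK).
- split; rewrite !in_setU1 !negb_or.
  + by rewrite (eq_sym u) wu (in_out_neq uK cK') !inE eqxx !andbF.
  + by rewrite (eq_sym v) wv (in_out_neq vK cK') !inE eqxx !andbF.
  + by rewrite (in_out_neq wK aK) (eq_sym a) ca (contra (subsetP RK a)).
  by rewrite (in_out_neq wK bK) (eq_sym b) cb (contra (subsetP RK b)).
- by apply: matchableU1; rewrite // !inE eqxx.
apply: independentS iK; rewrite setCS; apply/subsetP => z zK.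
rewrite !inE zK andbT; case: (z == u); case: (z == v); case: (z == w) => //=.
by rewrite orbT.
Qed.

(* All outer vertices but [b] turn out to be pendant at [u], so that [b] takes
   the place of [u] in the clique. *)
Lemma pendant_clique_swap u v a b c :
    odd #|K| -> u \in K -> v \in K -> a \notin K -> b \notin K -> c \notin K ->
    u != v -> a != b -> c != a -> c != b -> e u a -> e v b -> e u c ->
  pendant_clique u b (b |: (K :\ u)) /\ 1 < #|~: (u |: (b |: (K :\ u)))|.
Proof.
move=> oddK uK vK aK bK cNK uv ab ca cb eua evb euc.
have outer z : z \in K -> exists2 f, f \notin K & e z f.
  move=> zK; apply: odd_clique_outer_neighbor => //.
  by apply/card_gt0P; exists a; rewrite inE.
(* Using [v' b] once with [u a] and once with [u c] confines the outer neighbours of [z] to both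
   pairs, hence to [b]. The statement is general in [v'] because [v] itself is treated later with
   [w] in this role. *)
have only_b v' : v' \in K -> u != v' -> e v' b ->
    forall z, z \in K -> z != u -> z != v' ->
    forall f, f \notin K -> e z f -> f = b.
  move=> v'K uv' ev'b z zK zu zv' f fK ezf.
  have [fa|//] := odd_clique_disjoint_edges oddK uK v'K aK bK uv' eua ev'b ab
    zK zu zv' fK ezf.
  have [fc|//] := odd_clique_disjoint_edges oddK uK v'K cNK bK uv' euc ev'b cb
    zK zu zv' fK ezf.
  by rewrite -fc fa eqxx in ca.
have [w] : exists w, w \in K :\ u :\ v.
  apply/card_gt0P; move: oddK.
  rewrite (cardsD1 u) uK (cardsD1 v) !inE vK eq_sym uv.
  by case: #|_|.
rewrite !inE => /and3P[wv wu wK].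
have wb : e w b.
  have [f fK ewf] := outer w wK.
  by rewrite -(only_b v vK uv evb w wK wu wv f fK ewf).
have onlyb z f : z \in K -> z != u -> f \notin K -> e z f -> f = b.
  move=> zK zu; have [->|zv] := eqVneq z v; last exact: (only_b v).
  by apply: (only_b w); rewrite // eq_sym.
have adjb z : z \in K -> z != u -> e z b.
  move=> zK zu; have [f fK ezf] := outer z zK.
  by rewrite -(onlyb z f zK zu fK ezf).
have ub : u != b by rewrite (in_out_neq uK bK).
split; last first.
  have -> : ~: (u |: (b |: (K :\ u))) = ~: K :\ b.
    by rewrite setUCA setD1K // setCU setIC setDE.
  apply/card_gt1P; exists a, c; split; rewrite ?inE ?ab ?cb ?aK ?cNK //.
  by rewrite eq_sym.
split.
- split; rewrite ?inE ?eqxx //.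
  + by rewrite negb_or ub /=.
  + move=> x y; rewrite !inE.
    move=> /predU1P[->|/andP[xu xK]] /predU1P[->|/andP[yu yK]].
    * by rewrite eqxx.
    * by move=> _; rewrite e_sym; apply: adjb.
    * by move=> _; apply: adjb.
    exact: cK.
  rewrite cardsU1 !inE (negbTE bK) andbF.
  by move: oddK; rewrite (cardsD1 u K) uK.
- move=> z; rewrite !inE => /predU1P[->|/andP[zu zK] _]; first by rewrite eqxx.
  by apply: cK; rewrite // eq_sym.
move=> x y xu; rewrite !inE negb_or xu /= => /andP[xb xK] exy.
have yK := outer_neighbor xK exy.
apply/eqP/contraT => yu; rewrite e_sym in exy.
by rewrite (onlyb y x) // eqxx in xb.
Qed.

(** The bound in the third case provides two pendant vertices, which the degree count needs. *)
Lemma equimatchable_clique_structure :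
  [\/ clique e [set: T],
      odd n /\ exists x y, clique_minus_pair x y
    | exists x y C, pendant_clique x y C /\ 1 < #|~: (x |: C)|].
Proof.
have [K0|[a aNK]] := set_0Vmem (~: K).
  by constructor 1; rewrite -setC0 -K0 setCK.
have K'gt0 : 0 < #|~: K| by apply/card_gt0P; exists a.
rewrite inE in aNK; have nE := cardsC K.
have [oddK|evK] := boolP (odd #|K|).
  have outer z zK := @odd_clique_outer_neighbor z oddK K'gt0 zK.
  have [x eax] := has_neighbor a; have xK := outer_neighbor aNK eax.
  (* The vertex [z] is missed by [a], so its outer neighbour [b] is not [a], and [x a], [z b] are
     disjoint edges. *)
  have [z zK eaz] := maxK aNK.
  have zx : z != x by apply: contraNneq eaz => ->.
  have [b bK ezb] := outer z zK.
  have ab : a != b by apply: contraNneq eaz => ->; rewrite e_sym.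
  have exa : e x a by rewrite e_sym.
  (* A third outer vertex can be attached only to [x] or [z], and that vertex becomes the centre. *)
  have [c /and3P[cNK ca cb]|noc] :=
      pickP [pred c | [&& c \notin K, c != a & c != b]].
    constructor 3; have [w ecw] := has_neighbor c.
    have wK := outer_neighbor cNK ecw; rewrite e_sym in ecw.
    have xz : x != z by rewrite eq_sym.
    have [wx|wx] := eqVneq w x.
      rewrite wx in ecw; exists x, b, (b |: (K :\ x)).
      exact: (@pendant_clique_swap x z a b c).
    have [wz|wz] := eqVneq w z; last first.
      have [/eqP|/eqP] := odd_clique_disjoint_edges oddK xK zK aNK bK xz exa
        ezb ab wK wx wz cNK ecw.
        by rewrite (negbTE ca).
      by rewrite (negbTE cb).
    rewrite wz in ecw; exists z, a, (a |: (K :\ z)).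
    by apply: (@pendant_clique_swap z x b a c); rewrite // eq_sym.
  have CK : ~: K = [set a; b].
    apply/setP => c; rewrite !inE; have := noc c; rewrite /=.
    have [->|_] /= := eqVneq c a; first by rewrite aNK.
    have [->|_] /= := eqVneq c b; first by rewrite bK.
    by rewrite !andbT.
  constructor 2; split.
    by rewrite -nE CK cards2 ab oddD oddK.
  exists a, b; split=> //; first by apply: iK; rewrite inE.
    by rewrite -CK setCK.
  move=> w wa wb; have wK : w \in K.
    have : w \notin ~: K by rewrite CK !inE negb_or wa.
    by rewrite inE negbK.
  have [f] := outer w wK; rewrite -in_setC CK !inE => /orP[]/eqP-> ->//.
  by rewrite orbT.
have [z zK eaz] := maxK aNK.
(* A single outer vertex [a] makes [n = #|K| + 1] odd, and the pair is [a] with a vertex of [K] that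
   it misses. *)
have [K1|K2] := leqP #|~: K| 1.
  have CK : ~: K = [set a].
    apply/eqP; rewrite eq_sym eqEcard cards1 K1 andbT sub1set inE //.
  constructor 2; split; first by rewrite -nE CK cards1 addn1.
  have az := (in_out_neq zK aNK).1.
  exists a, z; split=> //.
    by apply: cliqueS cK; rewrite setCU -CK setCK subsetIl.
  move=> w wa wz; apply/orP; right; apply: cK => //.
  have : w \notin ~: K by rewrite CK !inE.
  by rewrite inE negbK.
have [x xK star] :
    exists2 x, x \in K & forall a w, a \notin K -> e a w -> w = x.
  apply: star_of_no_disjoint_edges => // u v a' b' uK vK a'K b'K uv.
  exact: (even_clique_no_disjoint_edges evK).
(* Without the star centre the clique is odd; any [y] in it will do, as [x] is adjacent to all of
   it. *)
have [y] : exists y, y \in K :\ x.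
  apply/card_gt0P; move: evK; rewrite (cardsD1 x) xK.
  by case: #|_|.
rewrite !inE => /andP[yx yK].
constructor 3; exists x, y, (K :\ x); split; last by rewrite setD1K.
split.
- split; rewrite ?inE ?eqxx ?yx //; first exact: cliqueS (subsetDl _ _) cK.
  by move: evK; rewrite (cardsD1 x) xK /= negbK.
- by move=> u; rewrite !inE => /andP[ux uK] _; apply: cK; rewrite // eq_sym.
by move=> u w ux; rewrite !inE ux /=; apply: star.
Qed.

End Forward.

(** * Reading the shapes off the degrees *)
Local Notation r := (num_deg e 1).
Local Notation p := (num_deg e (n - 1)).
Local Notation d := (degree e).

Lemma degree_eq v A : (forall w, e v w = (w \in A)) -> d v = #|A|.
Proof. by move=> eA; apply: eq_card => w; rewrite inE eA. Qed.

Lemma degree_le v A : (forall w, e v w -> w \in A) -> d v <= #|A|.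
Proof.
by move=> sA; apply/subset_leq_card/subsetP => w; rewrite inE => /sA.
Qed.

(** This is how adjacency is recovered from degrees: a degree that meets its upper bound determines
    the neighbourhood. *)
Lemma degree_max v A w :
  (forall w, e v w -> w \in A) -> d v = #|A| -> w \in A -> e v w.
Proof.
move=> sA dA wA; have /setP/(_ w) : [set w | e v w] = A; last by rewrite inE wA.
apply/eqP; rewrite eqEcard -dA leqnn andbT.
by apply/subsetP => u; rewrite inE => /sA.
Qed.

Lemma cardsC1n x : #|[set~ x]| = n - 1.
Proof. by rewrite cardsC1 subn1. Qed.

Lemma cardsC2 x y : x != y -> #|~: [set x; y]| = n - 2.
Proof. by move=> nxy; rewrite cardsCs setCK cards2 nxy. Qed.

Lemma degree_full v : d v = n - 1 <-> (forall w, w != v -> e v w).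
Proof.
split=> [dv w wv|adj].
  apply: (@degree_max v [set~ v]); rewrite ?cardsC1n ?inE //.
  by move=> u /adj_neq; rewrite !inE eq_sym.
rewrite -(cardsC1n v); apply: degree_eq => w; rewrite !inE.
by have [->|/adj->] := eqVneq w v; rewrite ?e_irr.
Qed.

Lemma degree1_unique v x w : d v = 1 -> e v x -> e v w -> w = x.
Proof.
move/eqP/cards1P=> [u /setP eu] evx evw.
have := eu x; have := eu w; rewrite !inE evx evw.
by move=> /esym/eqP-> /esym/eqP->.
Qed.

Lemma degree_gt0 v : 0 < d v.
Proof. by rewrite lt0n; apply: no_isolated. Qed.

Lemma num_deg1 k x : num_deg e k = 1 -> d x = k -> forall v, d v = k -> v = x.
Proof.
move/eqP/cards1P=> [u /setP eu] dx v dv.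
have := eu x; have := eu v; rewrite !inE dx dv eqxx.
by move=> /esym/eqP-> /esym/eqP->.
Qed.

(** * Complete graphs and pendant cliques in terms of degrees *)

Hypothesis n_ge4 : 4 <= n.

Lemma num_full_complete : p = n <-> clique e [set: T].
Proof.
split=> [pn x y _ _ nxy|cT].
  have full : [set v | d v == n - 1] = setT.
    by apply/eqP; rewrite eqEcard subsetT cardsT -[X in X <= _]pn leqnn.
  have /eqP dx : d x == n - 1 by have := in_setT x; rewrite -full inE.
  by move/degree_full: dx; apply; rewrite eq_sym.
rewrite -[RHS]cardsT; congr #|pred_of_set _|; apply/setP => v; rewrite !inE.
by apply/eqP/degree_full => w wv; apply: cT; rewrite // eq_sym.
Qed.

(* [K] is recovered from the degrees as the set of vertices of degree at least
   two other than [x]. *)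
Lemma pendant_cliqueI x y :
    x != y -> d x != 1 -> d y != 1 -> ~~ odd (n - r) ->
    (forall z, z != x -> z != y -> e x z) ->
    (forall z, z != x -> z != y -> d z = 1 \/ d z = n - r - 1) ->
  pendant_clique x y [set v | (v != x) && (d v != 1)].
Proof.
move=> nxy dx dy evn xadj deg; set K := [set v | _].
have cardK : #|K| = n - r - 1.
  have -> : K = (~: [set v | d v == 1]) :\ x by apply/setP => v; rewrite !inE.
  have := cardsD1 x (~: [set v | d v == 1]); rewrite !inE dx.
  have := cardsC [set v | d v == 1]; rewrite /num_deg; lia.
(* A vertex of degree 1 has only [x] as neighbour, so those of [z] lie in [x |: (K :\ z)], a set of
   exactly [d z] elements. The adjacencies of [y] follow by symmetry. *)
have Kadj z : z \in K -> z != y -> forall w, w \in K -> w != z -> e z w.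
  move=> zK zy w wK wz; move: (zK); rewrite inE => /andP[zx dz].
  have {}dz : d z = n - r - 1.
    by case: (deg z zx zy) => // dz1; rewrite dz1 in dz.
  apply: (@degree_max z (x |: (K :\ z))); last first.
  - by rewrite in_setU1 in_setD1 wz wK orbT.
  - by rewrite cardsU1 !inE eqxx andbF dz -cardK (cardsD1 z K) zK.
  move=> u ezu; rewrite !inE; case: (eqVneq u x) => //= ux.
  rewrite eq_sym adj_neq //=; apply: contraNneq dy => du.
  have [<-|uy] := eqVneq u y; first by rewrite du.
  have eux : e u x by rewrite e_sym xadj.
  have euz : e u z by rewrite e_sym.
  by rewrite (degree1_unique du eux euz) eqxx in zx.
have yK : y \in K by rewrite inE eq_sym nxy.
split.
- split; rewrite ?inE ?eqxx ?dy ?andbT //; first by rewrite eq_sym.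
    move=> z w zK wK nzw; have [zy|zy] := eqVneq z y.
      by rewrite e_sym; apply: Kadj => //; rewrite -zy eq_sym.
    by apply: Kadj => //; rewrite eq_sym.
  move: cardK evn; rewrite (cardsD1 y) yK; case: (n - r) => // m.
  by move=> ->; rewrite subn1 /= negbK.
- by move=> z; rewrite inE => /andP[zx _]; apply: xadj.
move=> v w vx; rewrite inE vx /= negbK => /eqP dv.
apply: degree1_unique => //; rewrite e_sym xadj //.
by apply: contraNneq dy => <-; rewrite dv.
Qed.

Lemma pendant_clique_of_star :
  r = n - 1 -> p = 1 ->
  exists x y K, pendant_clique x y K /\ exists v, (v != x) && (v \notin K).
Proof.
move=> rn p1; have /cards1P[x /setP ex] : p == 1 by rewrite p1.
have dx : d x = n - 1 by have := ex x; rewrite !inE eqxx => /eqP.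
have xadj := (degree_full x).1 dx.
have deg1 v : v != x -> d v = 1.
  move=> vx; have : v \in [set~ x] by rewrite !inE.
  suff <- : [set v | d v == 1] = [set~ x] by rewrite inE => /eqP.
  apply/eqP; rewrite eqEcard cardsC1n -rn leqnn andbT.
  apply/subsetP => w; rewrite !inE; apply: contraTneq => ->.
  by rewrite dx; lia.
have [y yx] : exists y, y \in [set~ x].
  by apply/set0Pn; rewrite -card_gt0 cardsC1n; lia.
rewrite !inE in yx.
(* A star is the case of a one-element clique, formed by any leaf; another leaf is the vertex
   outside. *)
exists x, y, [set y]; split; last first.
  have [v] : exists v, v \in ~: [set x; y].
    by apply/set0Pn; rewrite -card_gt0 cardsC2 1?eq_sym //; lia.
  by rewrite !inE negb_or => vP; exists v; rewrite inE.
split=> [|z|v w vx _].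
- split; rewrite ?inE ?cards1 ?eqxx 1?eq_sym //.
  by move=> u v; rewrite !inE => /eqP-> /eqP->; rewrite eqxx.
- by rewrite inE => /eqP->; rewrite eqxx.
by apply: degree1_unique; rewrite ?deg1 // e_sym; apply: xadj.
Qed.

(** Common to (iii) and (iv); a vertex of degree 1 serves as the witness outside [K] required for
    equimatchability. *)
Lemma pendant_clique_of_degrees x y :
    2 <= r -> x != y -> d x != 1 -> d y != 1 -> ~~ odd (n - r) ->
    (forall z, z != x -> z != y -> e x z) ->
    (forall z, z != x -> z != y -> d z = 1 \/ d z = n - r - 1) ->
  exists x y K, pendant_clique x y K /\ exists v, (v != x) && (v \notin K).
Proof.
move=> r2 nxy dx dy evn xadj deg.
exists x, y, [set v | (v != x) && (d v != 1)]; split.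
  exact: pendant_cliqueI.
have /set0Pn[v] : [set v | d v == 1] != set0.
  by rewrite -card_gt0; apply: leq_trans r2.
rewrite inE => dv; exists v; rewrite inE dv andbF andbT.
by apply: contraNneq dx => <-.
Qed.

Lemma pendant_clique_of_iii :
    p = 1 -> 2 <= r -> ~~ odd (n - r) ->
    (forall v, [\/ d v = 1, d v = n - r - 1 | d v = n - 1]) ->
  exists x y K, pendant_clique x y K /\ exists v, (v != x) && (v \notin K).
Proof.
move=> p1 r2 evn deg; have /cards1P[x /setP ex] : p == 1 by rewrite p1.
have dx : d x = n - 1 by have := ex x; rewrite !inE eqxx => /eqP.
have dx1 : d x != 1 by rewrite dx; lia.
(* The vertices of degree other than 1 are even in number and include [x], so there is a second
   one. *)
have [y] : exists y, y \in (~: [set v | d v == 1]) :\ x.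
  apply/set0Pn; rewrite -card_gt0.
  have := cardsD1 x (~: [set v | d v == 1]); rewrite !inE dx1.
  have := cardsC [set v | d v == 1]; move: evn; rewrite /num_deg; lia.
rewrite !inE => /andP[yx dy].
apply: (@pendant_clique_of_degrees x y) => //; first by rewrite eq_sym.
  by move=> z zx _; apply: (degree_full x).1.
move=> z zx _; case: (deg z) => dz; [by left | by right |].
by rewrite (num_deg1 p1 dx dz) eqxx in zx.
Qed.

Lemma pendant_clique_of_iv x y :
    2 <= r -> ~~ odd (n - r) -> x != y -> ~~ e x y ->
    d x = n - 2 -> d y = n - r - 2 ->
    (forall v, v \notin [set x; y] -> d v = 1 \/ d v = n - r - 1) ->
  exists x y K, pendant_clique x y K /\ exists v, (v != x) && (v \notin K).
Proof.
move=> r2 evn nxy exy dx dy deg.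
apply: (@pendant_clique_of_degrees x y) => //.
- by rewrite dx; lia.
(* Here [d y = 1] would mean [n - r = 3], against parity. *)
- by rewrite dy; have := degree_gt0 y; rewrite dy; move: (n - r) evn => m; lia.
- move=> z zx zy; apply: (@degree_max x (~: [set x; y])).
  + move=> w exw; rewrite !inE negb_or eq_sym adj_neq //=.
    by apply: contraNneq exy => <-.
  + by rewrite cardsC2.
  + by rewrite !inE negb_or zx.
by move=> z zx zy; apply: deg; rewrite !inE negb_or zx.
Qed.

(** A one-element [K] gives a star, case (ii). Otherwise the vertices of degree 1 are those outside
    [x |: K], so [n - r = #|K| + 1], and whether [x y] is an edge separates (iii) from (iv). *)
Lemma pendant_clique_degrees x y K :
    pendant_clique x y K -> 2 <= #|~: (x |: K)| ->
  [\/ r = n - 1 /\ p = 1,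
      [/\ p = 1, 2 <= r, ~~ odd (n - r)
        & forall v, [\/ d v = 1, d v = n - r - 1 | d v = n - 1]]
    | [/\ p = 0, 2 <= r, ~~ odd (n - r)
        & exists x y, [/\ x != y, ~~ e x y, d x = n - 2, d y = n - r - 2
             & forall v, v \notin [set x; y] -> d v = 1 \/ d v = n - r - 1]]].
Proof.
move=> pK P2; have [[yK xK cK oddK] xadj pend] := pK.
have Px v := @pendant_clique_adj x y K v pK.
have nxy : x != y by apply: contraNneq xK => ->.
have nE : n = #|K| + 1 + #|~: (x |: K)|.
  by rewrite -(cardsC (x |: K)) cardsU1 xK add1n addn1.
have dP v : v != x -> v \notin K -> d v = 1.
  move=> vx vK; rewrite -(cards1 x); apply: degree_eq => w; rewrite inE.
  by apply/idP/eqP => [/(pend v w vx vK)|->] //; apply: Px.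
have KP z w : z \in K -> e z w -> w \in x |: (K :\ z).
  move=> zK ezw; rewrite !inE; case: eqVneq => //= wx.
  rewrite eq_sym adj_neq //=; apply: contraNT xK => wK.
  by rewrite -(pend w z wx wK) // e_sym.
have cardKz z : z \in K -> #|x |: (K :\ z)| = #|K|.
  by move=> zK; rewrite cardsU1 !inE negb_and xK orbT (cardsD1 z K) zK.
(* The disjunction ensures that [x z] is an edge. *)
have dK z : z \in K -> (z != y) || e x y -> d z = #|K|.
  move=> zK zy; rewrite -(cardKz z zK); apply: degree_eq => w.
  apply/idP/idP => [/KP|]; first exact.
  rewrite !inE => /predU1P[->|/andP[wz wK]].
    by rewrite e_sym; case: eqVneq zy => [->|zy _] //=; apply: xadj.
  by apply: cK; rewrite // eq_sym.
have fullx : e x y -> d x = n - 1.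
  move=> exy; apply/degree_full => w wx.
  have [->|wy] := eqVneq w y; first exact: exy.
  have [wK|wK] := boolP (w \in K); first exact: xadj.
  by rewrite e_sym; apply: Px.
have dK1 : 1 < #|K| -> forall z, z \in K -> d z != 1.
  move=> K1 z zK; have [->|zy] := eqVneq z y; last by rewrite dK ?zy //; lia.
  have : #|K :\ y| <= d y.
    apply/subset_leq_card/subsetP => w; rewrite !inE => /andP[wy wK].
    by apply: cK; rewrite // eq_sym.
  by have := cardsD1 y K; rewrite yK; lia.
have dxle : n - 2 <= d x.
  rewrite -(cardsC2 nxy); apply/subset_leq_card/subsetP => w.
  rewrite !inE negb_or => /andP[wx wy].
  have [wK|wK] := boolP (w \in K); first exact: xadj.
  by rewrite e_sym; apply: Px.
have notfull v : v != x -> d v != n - 1.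
  move=> vx; have [vK|vK] := boolP (v \in K); last by rewrite dP //; lia.
  have := degree_le (fun w => KP v w vK); rewrite (cardKz v vK).
  by move: nE P2; lia.
have rE : 1 < #|K| -> r = #|~: (x |: K)|.
  move=> K1; apply: eq_card => v; rewrite !inE negb_or.
  have [->|vx] /= := eqVneq v x; first by apply/eqP; lia.
  have [vK|vK] := boolP (v \in K); first by rewrite (negbTE (dK1 K1 v vK)).
  by rewrite dP.
have p1 : e x y -> p = 1.
  move=> exy; rewrite -[RHS](cards1 x); apply: eq_card => v; rewrite !inE.
  by have [->|/notfull/negbTE->] := eqVneq v x; rewrite ?fullx ?eqxx.
have [K1|K1] := leqP #|K| 1.
  (* The only possible neighbour of [y] is then [x], and [y] is not isolated. *)
  have Ky z : z \in K -> z = y by move=> zK; apply: (card_le1_eqP K1).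
  have exy : e x y.
    have [w eyw] := has_neighbor y.
    have := KP y w yK eyw; rewrite !inE => /predU1P[<-|/andP[wy /Ky wy']].
      by rewrite e_sym.
    by rewrite wy' eqxx in wy.
  constructor 1; split; last exact: p1.
  rewrite -[RHS](cardsC1n x); apply: eq_card => v; rewrite !inE.
  have [->|vx] /= := eqVneq v x; first by apply/eqP; rewrite fullx //; lia.
  have [vK|vK] := boolP (v \in K); last by rewrite dP.
  by rewrite dK ?exy ?orbT // eqn_leq K1 card_gt0; apply/set0Pn; exists y.
have nrE : n - r = #|K|.+1 by rewrite rE // [n]nE addnK addn1.
rewrite -(rE K1) in P2.
have [exy|exy] := boolP (e x y).
  constructor 2; split=> //; [exact: p1 | by rewrite nrE /= negbK |].
  move=> v; have [->|vx] := eqVneq v x; first by constructor 3; apply: fullx.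
  have [vK|vK] := boolP (v \in K); last by constructor 1; apply: dP.
  by constructor 2; rewrite dK ?exy ?orbT // nrE subn1.
have dx : d x = n - 2.
  apply/eqP; rewrite eqn_leq dxle andbT -(cardsC2 nxy).
  apply: degree_le => w exw; rewrite !inE negb_or eq_sym adj_neq //=.
  by apply: contraNneq exy => <-.
constructor 3; split=> //; [| by rewrite nrE /= negbK |].
  apply/eqP; rewrite cards_eq0; apply/eqP/setP => v; rewrite !inE.
  by have [->|/notfull/negbTE//] := eqVneq v x; apply/negbTE; lia.
exists x, y; split=> //.
  rewrite nrE subSS subn1 (cardsD1 y K) yK /=; apply: degree_eq => w.
  apply/idP/idP => [eyw|]; last first.
    by rewrite !inE => /andP[wy wK]; apply: cK; rewrite // eq_sym.
  have := KP y w yK eyw; rewrite !inE => /predU1P[wx|//].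
  by rewrite wx e_sym (negbTE exy) in eyw.
move=> v; rewrite !inE negb_or => /andP[vx vy].
have [vK|vK] := boolP (v \in K); last by left; apply: dP.
by right; rewrite dK ?vy // nrE subn1.
Qed.

(** * Degree sums and cliques minus a pair *)

Lemma degree_sum v : d v = \sum_w e v w.
Proof.
rewrite /degree -sum1_card big_mkcond.
by apply: eq_bigr => w _; rewrite inE; case: e.
Qed.

Lemma degree_pair_sum x y : x != y ->
  d x + d y = (e x y).*2 + \sum_(z in ~: [set x; y]) (e z x + e z y).
Proof.
move=> nxy; rewrite !degree_sum -big_split /=.
rewrite (bigID [in [set x; y]]) /=; congr (_ + _).
  rewrite (bigD1 x) /=; last by rewrite !inE eqxx.
  rewrite (big_pred1 y) => [|z].
    by rewrite !e_irr (e_sym y x) addn0 addnn.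
  by rewrite /= !inE; case: eqVneq => [->|]; rewrite ?andbT //= (negbTE nxy).
apply: eq_big => [z|z _]; first by rewrite in_setC.
by rewrite !(e_sym z).
Qed.

(** Split over the same index set as [degree_pair_sum], so that the two can be compared term by
    term. *)
Lemma num_deg_pair k x y : x != y ->
  num_deg e k = (d x == k) + (d y == k) + \sum_(z in ~: [set x; y]) (d z == k).
Proof.
move=> nxy; have -> : num_deg e k = \sum_z (d z == k).
  rewrite /num_deg -sum1_card big_mkcond.
  by apply: eq_bigr => z _; rewrite inE; case: eqP.
rewrite (bigID [in [set x; y]]) /=; congr (_ + _).
  rewrite (bigD1 x) /=; last by rewrite !inE eqxx.
  congr (_ + _); rewrite (big_pred1 y) // => z.
  by rewrite /= !inE; case: eqVneq => [->|]; rewrite ?andbT //= (negbTE nxy).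
by apply: eq_bigl => z; rewrite in_setC.
Qed.

Lemma degree_notfull v w : w != v -> ~~ e v w -> d v != n - 1.
Proof. by move=> wv; apply: contraNneq => /degree_full; apply. Qed.

Lemma degree_le_nonadj2 z x y :
  x != y -> z != x -> z != y -> ~~ e z x -> ~~ e z y -> d z <= n - 3.
Proof.
move=> nxy zx zy ezx ezy.
have -> : n - 3 = #|~: [set x; y] :\ z|.
  have := cardsD1 z (~: [set x; y]).
  by rewrite cardsC2 // !inE negb_or zx zy; lia.
apply: degree_le => w ezw; rewrite !inE negb_or eq_sym adj_neq //=.
by apply/andP; split; [apply: contraNneq ezx => <-|apply: contraNneq ezy => <-].
Qed.

Lemma degree_nonadj1 z w :
  d z = n - 2 -> w != z -> ~~ e z w -> forall u, u != z -> u != w -> e z u.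
Proof.
move=> dz wz ezw u uz uw; apply: contraT => ezu.
have := @degree_le_nonadj2 z u w uw; rewrite !(eq_sym z) => /(_ uz wz ezu ezw).
by rewrite dz; lia.
Qed.

Lemma clique_minus_pair_degree x y z :
  clique_minus_pair x y -> z \in ~: [set x; y] ->
  d z = if e z x && e z y then n - 1 else n - 2.
Proof.
move=> [nxy exy cK dom]; rewrite !inE negb_or => /andP[zx zy].
have zadj w : w != x -> w != y -> w != z -> e z w.
  by move=> wx wy wz; apply: cK; rewrite ?inE ?negb_or ?zx ?zy ?wx // eq_sym.
have [ezx|ezx] := boolP (e z x); have [ezy|ezy] := boolP (e z y) => /=.
- apply/degree_full => w wz.
  by have [->//|wx] := eqVneq w x; have [->//|wy] := eqVneq w y; apply: zadj.
- rewrite -(cardsC2 zy); apply: degree_eq => w; rewrite !inE negb_or.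
  have [->|wz] := eqVneq w z; first by rewrite e_irr.
  have [->|wy] := eqVneq w y; first by rewrite (negbTE ezy).
  by have [->|wx] := eqVneq w x; [rewrite ezx | rewrite zadj].
- rewrite -(cardsC2 zx); apply: degree_eq => w; rewrite !inE negb_or.
  have [->|wz] := eqVneq w z; first by rewrite e_irr.
  have [->|wx] := eqVneq w x; first by rewrite (negbTE ezx).
  by have [->|wy] := eqVneq w y; [rewrite ezy | rewrite zadj].
by have := dom z zx zy; rewrite (negbTE ezx) (negbTE ezy).
Qed.

Lemma n2_neq_n1 : (n - 2 == n - 1) = false.
Proof. by apply/eqP; lia. Qed.

(** Each of the [n - 2] vertices outside the pair sends one edge to it, and a second one exactly
    when its degree is [n - 1]; neither [x] nor [y] has that degree. *)
Lemma clique_minus_pair_degrees x y : clique_minus_pair x y ->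
  d x + d y = p + n - 2 /\
  forall v, v \notin [set x; y] -> d v = n - 1 \/ d v = n - 2.
Proof.
move=> pxy; have [nxy exy cK dom] := pxy; split; last first.
  move=> v; rewrite -in_setC => /(clique_minus_pair_degree pxy)->.
  by case: (_ && _); [left | right].
have exy' : ~~ e y x by rewrite e_sym.
rewrite degree_pair_sum // (num_deg_pair _ nxy) (negbTE exy).
have nyx : y != x by rewrite eq_sym.
rewrite (negbTE (degree_notfull nyx exy)) (negbTE (degree_notfull nxy exy')).
rewrite !add0n -addnBA; last by lia.
rewrite -(cardsC2 nxy) -sum1_card -big_split /=; apply: eq_bigr => z zP.
rewrite (clique_minus_pair_degree pxy zP).
move: (zP); rewrite !inE negb_or => /andP[/dom /[apply] domz].
by case: (e z x) domz; case: (e z y); rewrite //= ?eqxx ?n2_neq_n1.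
Qed.

Lemma clique_minus_pair_of_degrees x y :
    x != y -> d x + d y = p + n - 2 ->
    (forall v, v \notin [set x; y] -> d v = n - 1 \/ d v = n - 2) ->
  clique e [set: T] \/ clique_minus_pair x y.
Proof.
move=> nxy dxy deg.
(* The number [f z] of edges from [z] to the pair is at least [g z]: a vertex of degree [n - 2]
   misses at most one of [x] and [y], one of degree [n - 1] none. *)
pose f z : nat := e z x + e z y; pose g z : nat := 1 + (d z == n - 1).
have le_gf z : z \in ~: [set x; y] -> g z <= f z ?= iff (g z == f z).
  move=> zP; split=> //; have := zP; rewrite !inE negb_or => /andP[zx zy].
  rewrite /f /g; have [/degree_full adj|dz] := eqVneq.
    by rewrite !adj 1?eq_sym.
  have [ezx|ezx] := boolP (e z x); first by [].
  have [ezy|ezy] := boolP (e z y); first by [].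
  have := degree_le_nonadj2 nxy zx zy ezx ezy.
  have /deg[dz1|->] : z \notin [set x; y] by rewrite -in_setC.
    by rewrite dz1 eqxx in dz.
  by lia.
have sum_g : p + n - 2 =
    (d x == n - 1) + (d y == n - 1) + \sum_(z in ~: [set x; y]) g z.
  rewrite big_split /= sum1_card cardsC2 // (num_deg_pair _ nxy).
  rewrite -addnBA; last exact: leq_trans n_ge4.
  by rewrite -!addnA; do 2 congr (_ + _); rewrite addnC.
have [le_sum eq_sum] := leqif_sum le_gf.
have sum_f : (d x == n - 1) + (d y == n - 1) + \sum_(z in ~: [set x; y]) g z =
    (e x y).*2 + \sum_(z in ~: [set x; y]) f z.
  by rewrite -sum_g -dxy; apply: degree_pair_sum.
have yx : y != x by rewrite eq_sym.
have gfP : \sum_(z in ~: [set x; y]) g z = \sum_(z in ~: [set x; y]) f z ->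
    forall z, z \in ~: [set x; y] -> g z = f z.
  move/eqP; rewrite eq_sum => /forall_inP gf z zS; exact/eqP/gf.
have [exy|exy] := boolP (e x y); [left|right].
  (* The edge [x y] contributes 2, at least as much as both indicators together, so both are 1 and
     the two sums agree. Then [f z = 2] forces [d z = n - 1] for all other [z]. *)
  have [dx [dy /gfP gf]] : d x = n - 1 /\ d y = n - 1 /\
      \sum_(z in ~: [set x; y]) g z = \sum_(z in ~: [set x; y]) f z.
    move: sum_f le_sum; rewrite exy.
    move: (\sum_(z in _) g z) (\sum_(z in _) f z) => a b.
    case: eqP => dx; case: eqP => dy /= sum_ab le_ab; try lia.
    by split=> //; split=> //; lia.
  have full z : d z = n - 1.
    have [->//|zx] := eqVneq z x; have [->//|zy] := eqVneq z y.
    have := gf z; rewrite /g /f !inE negb_or zx zy !(e_sym z) => /(_ isT).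
    rewrite (proj1 (degree_full x)) // (proj1 (degree_full y)) //.
    by case: eqP.
  by move=> u v _ _ nuv; apply: (proj1 (degree_full u)); rewrite // eq_sym.
have exy' : ~~ e y x by rewrite e_sym.
move: sum_f; rewrite (negbTE (degree_notfull yx exy)).
rewrite (negbTE (degree_notfull nxy exy')) (negbTE exy) !add0n => /gfP gf.
split=> // [u v uS vS nuv|z zx zy]; last first.
  have := gf z; rewrite !inE negb_or zx zy => /(_ isT).
  by rewrite /g /f; case: (e z x); case: (e z y).
(* If [u] has degree [n - 2], then [f u = 1]: the only vertex it misses is [x] or [y], so it is
   adjacent to [v]. *)
have := gf u uS; rewrite /g /f; have [du _|du] := eqVneq.
  by apply: (proj1 (degree_full u)); rewrite // eq_sym.
have {}du : d u = n - 2.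
  have /deg[du1|//] : u \notin [set x; y] by rewrite -in_setC.
  by rewrite du1 eqxx in du.
move: uS vS; rewrite !inE !negb_or => /andP[ux uy] /andP[vx vy].
have [eux|eux] := boolP (e u x); have [euy|euy] := boolP (e u y) => // _.
  by apply: (degree_nonadj1 du _ euy); rewrite // eq_sym.
by apply: (degree_nonadj1 du _ eux); rewrite // eq_sym.
Qed.
End Matchable.
Theorem theorem3p1 (T : finType) (e : rel T)
    (e_sym : symmetric e) (e_irr : irreflexive e)
    (n_ge4 : 4 <= #|T|) (no_isolated : forall v : T, ~~ isolated e v) :
  let n := #|T| in
  let r := num_deg e 1 in
  let p := num_deg e (n - 1) in
  let d := degree e in
  (equimatchable e /\ split_graph e) <->
  (p = n)
  \/ (r = n - 1 /\ p = 1)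
  \/ [/\ p = 1, 2 <= r, ~~ odd (n - r)
       & forall v : T, [\/ d v = 1, d v = n - r - 1 | d v = n - 1]]
  \/ [/\ p = 0, 2 <= r, ~~ odd (n - r)
       & exists x y : T,
           [/\ x != y, ~~ e x y, d x = n - 2, d y = n - r - 2
             & forall v : T, v \notin [set x; y] ->
                 d v = 1 \/ d v = n - r - 1]]
  \/ (odd n /\
      exists x y : T,
        [/\ x != y, d x + d y = p + n - 2
          & forall v : T, v \notin [set x; y] ->
              d v = n - 1 \/ d v = n - 2]).
Proof.
move=> n r p d; rewrite {}/r {}/p {}/d {}/n; split.
  move=> [eqm /(split_maximal_clique e_sym)[K [cK iK maxK]]].
  have [cT|[oddT [x [y pxy]]]|[x [y [C [pxC C2]]]]] :=
      equimatchable_clique_structure e_sym e_irr no_isolated eqm cK iK maxK.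
  - by left; apply/num_full_complete.
  - have [nxy _ _ _] := pxy.
    have [sxy deg] := clique_minus_pair_degrees e_sym e_irr n_ge4 pxy.
    by do 4 right; split=> //; exists x, y.
  have [] := pendant_clique_degrees e_sym e_irr no_isolated n_ge4 pxC C2; tauto.
have pend : (exists x y K, pendant_clique e x y K /\
      exists v, (v != x) && (v \notin K)) -> equimatchable e /\ split_graph e.
  move=> [x [y [K [pK exq]]]].
  split; last exact: (pendant_clique_split e_sym e_irr pK).
  exact: (pendant_clique_equimatchable e_sym e_irr no_isolated pK exq).
case=> [|[[rn p1]|[[p1 r2 evn deg]|[[p0 r2 evn]|[oddT]]]]].
- move=> /(num_full_complete e_irr) cT; split; last exact: complete_split.
  exact: complete_equimatchable.
- by apply: pend; apply: pendant_clique_of_star.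
- by apply: pend; apply: pendant_clique_of_iii.
- move=> [x [y [nxy exy dx dy deg]]]; apply: pend.
  exact: (@pendant_clique_of_iv _ _ e_sym e_irr no_isolated n_ge4 x y).
move=> [x [y [nxy dxy deg]]].
(* Complete graphs also satisfy the degree equation of (v), so they are split off first. *)
have [cT|pxy] := clique_minus_pair_of_degrees e_sym e_irr n_ge4 nxy dxy deg.
  by split; [apply: complete_equimatchable | apply: complete_split].
split; first exact: clique_minus_pair_equimatchable pxy oddT.
exact: (clique_minus_pair_split e_sym e_irr pxy).
Qed.
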